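(* The Karvatskyi--Pratsiovytyi conjecture is false. That is, there exist sequences of positive real numbers $(a_n)_{n=1}^\infty$, $(b_n)_{n=1}^\infty$, $(c_n)_{n=1}^\infty$ such that the series $\sum_{n=1}^\infty a_n$ and $\sum_{n=1}^\infty b_n$ converge, the achievement sets $E(a_n)$ and $E(b_n)$ have the same topological type, and for every $n\in\mathbb{N}$ $$a_n\le c_n\le b_n \quad\text{and}\quad \Bigl( b_n\le \sum_{i=n+1}^\infty a_i \ \text{ or }\ \sum_{i=n+1}^\infty b_i< a_n\Bigr),$$ but the three sets $E(a_n)$, $E(b_n)$, $E(c_n)$ do not all have the same topological type.
   Context: Here $\mathbb{N}=\{1,2,3,\dots\}$. For a sequence $(u_n)_{n=1}^\infty$ of positive real numbers with $\sum_{n=1}^\infty u_n<\infty$, its achievement set is $$E(u_n)=\left\{\sum_{n=1}^\infty \varepsilon_n u_n : \varepsilon_n\in\{0,1\}\text{ for all } n\right\}\subset\mathbb{R}.$$ It is known that every such $E(u_n)$ is of exactly one of the following three topological types: (i) a finite union of closed bounded intervals; (ii) a Cantor-type set, i.e. a set homeomorphic to the Cantor set; (iii) a Cantorval, i.e. a set homeomorphic to the Guthrie--Nymann achievement set, which is $E(u_n)$ for $u_{2k-1}=\frac{3}{4^k}$, $u_{2k}=\frac{2}{4^k}$ ($k\ge 1$). Two achievement sets ''have the same topological type'' if they belong to the same one of these three classes. The Karvatskyi--Pratsiovytyi conjecture asserts: if $\sum a_n$ and $\sum b_n$ are convergent series of positive terms such that $E(a_n)$ and $E(b_n)$ have the same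 topological type, and if for all $n\in\mathbb{N}$ one has $a_n\le c_n\le b_n$ and at least one of $b_n\le \sum_{i=n+1}^\infty a_i$, $\sum_{i=n+1}^\infty b_i<a_n$ holds, then $E(a_n)$, $E(b_n)$ and $E(c_n)$ have the same topological type. *)

(* Defs.v *)
From HB Require Import structures.
From mathcomp Require Export all_boot all_order all_algebra.
From mathcomp Require Export all_classical all_reals all_analysis.
Export Order.TTheory GRing.Theory Num.Theory.
Export numFieldNormedType.Exports.

Set Implicit Arguments.
Unset Strict Implicit.
Unset Printing Implicit Defensive.

Local Open Scope classical_set_scope.
Local Open Scope ring_scope.

(* Sequences are indexed from 0: [u n] stands for the mathematical $u_{n+1}$. *)

(* $\sum_{i \ge m} u_i$, a junk value when the series diverges. *)
Definition sum_from (R : realType) (m : nat) (u : R^nat) : R :=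
  limn (fun n => \sum_(m <= i < n) u i).

(* Meant for summable [u >= 0], for which every subseries converges. *)
Definition achievement_set (R : realType) (u : R^nat) : set R :=
  [set x | exists eps : nat -> bool,
      x = sum_from 0 (fun n => (eps n)%:R * u n)].

(* [f] and [g] are total functions, of which only the restrictions to [A] and
   [B] matter; [{within A, continuous f}] is continuity for the subspace
   topology of [A]. *)
Definition homeomorphic (T U : topologicalType) (A : set T) (B : set U) : Prop :=
  exists (f : T -> U) (g : U -> T),
    [/\ set_fun A B f, set_fun B A g,
        (forall x, A x -> g (f x) = x) /\ (forall y, B y -> f (g y) = y),
        {within A, continuous f} & {within B, continuous g}].

(* $u_{2k-1} = 3/4^k$ and $u_{2k} = 2/4^k$ for $k \ge 1$; with indices from 0,
   the even positions $2(k-1)$ carry $3/4^k$ and the odd ones $2k-1$ carry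
   $2/4^k$. *)
Definition guthrie_nymann (R : realType) : R^nat :=
  fun n => (if odd n then 2 else 3) / 4 ^+ (n./2).+1.

(* Intervals are nondegenerate. This excludes nothing relevant: an achievement
   set of a positive summable sequence has no isolated point. *)
Definition finite_union_of_intervals (R : realType) (A : set R) : Prop :=
  exists s : seq (R * R),
    (forall p, p \in s -> p.1 < p.2) /\
    A = [set x | exists2 p, p \in s & p.1 <= x <= p.2].

Definition cantor_type (R : realType) (A : set R) : Prop :=
  homeomorphic A [set: cantor_space].

Definition cantorval (R : realType) (A : set R) : Prop :=
  homeomorphic A (achievement_set (@guthrie_nymann R)).

Variant topological_type := FiniteUnionOfIntervals | CantorType | Cantorval.

Definition has_topological_type (R : realType) (t : topological_type)
    (A : set R) : Prop :=
  match t with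
  | FiniteUnionOfIntervals => finite_union_of_intervals A
  | CantorType => cantor_type A
  | Cantorval => cantorval A
  end.

Definition same_topological_type (R : realType) (A B : set R) : Prop :=
  exists t, has_topological_type t A /\ has_topological_type t B.

Definition same_topological_type3 (R : realType) (A B C : set R) : Prop :=
  exists t, [/\ has_topological_type t A, has_topological_type t B &
                has_topological_type t C].

(* Main.v *)
Require Import Defs.
From mathcomp Require Import ring lra zify.

Set Implicit Arguments.
Unset Strict Implicit.
Unset Printing Implicit Defensive.

(** The terms need not be decreasing.  Take [a = (1, 2, 1, 2, ..)],
    [b = (3/2, 3, 3/2, 3, ..)] and [c = (3/2, 2, 3/2, 2, ..)] over the powers
    [4, 4, 16, 16, ..].  The subset sums of [{1, 2}] are the four base-4 digits,
    so [E(a) = [0, 1]] and [E(b) = [0, 3/2]].  In [E(c)] the terms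
    after the [k]-th pair add up to [7/6 / 4^k], less than the smallest earlier
    term [3/2 / 4^k]; hence [E(c)] has gaps accumulating at
    its minimum [0] and is no finite union of intervals.  The same kind of gap
    shows that the Guthrie-Nymann set is disconnected, so the interval [E(a)] is
    of no other type. *)

Local Open Scope classical_set_scope.
Local Open Scope ring_scope.

(** * Decay against powers of 4, and sums by telescoping *)

Lemma bounded_div4_cvg0 (R : realType) (f : R^nat) (M : R) :
  (forall n, `|f n| <= M) -> f n / 4 ^+ (n./2).+1 @[n --> \oo] --> 0.
Proof.
move=> fM; apply/norm_cvg0P.
have h := @cvg_geometric R M 2^-1 _.
apply: (@squeeze_cvgr _ _ _ _ (fun=> 0) (geometric M 2^-1)); last 2 first.
- exact: cvg_cst.
- by apply: h; rewrite ger0_norm; lra.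
apply: nearW => n; rewrite normr_ge0 /= normrM normfV normrX.
rewrite (ger0_norm (_ : 0 <= 4)) //; apply: ler_pM => //.
rewrite exprVn lef_pV2 ?posrE ?exprn_gt0 //.
(* The comparison is [2 ^+ n <= 4 ^+ (n./2).+1], true since [n] is at most twice [n./2], plus
   one. *)
rewrite (_ : 4 = 2 ^+ 2 :> R); last by ring.
by rewrite -exprM ler_eXn2l ?ltr1n //; have := odd_double_half n; lia.
Qed.

Lemma sum_telescope_cvg (R : realType) (u T : R^nat) (m : nat) :
  (forall n, u n = T n - T n.+1) -> T n @[n --> \oo] --> 0 ->
  \sum_(m <= i < n) u i @[n --> \oo] --> T m.
Proof.
move=> uT T0; have h : T m - T n @[n --> \oo] --> T m.
  by rewrite -[X in _ --> X]subr0; apply: cvgB => //; exact: cvg_cst.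
apply: cvg_trans h; apply: near_eq_cvg; near=> n.
have mn : (m <= n)%N by near: n; exact: nbhs_infty_ge.
rewrite (eq_bigr (fun i => - (T i.+1 - T i))); last by move=> i _; rewrite uT opprB.
by rewrite sumrN telescope_sumr // opprB.
Unshelve. all: end_near. Qed.

Lemma sum_from_telescope (R : realType) (u T : R^nat) (m : nat) :
  (forall n, u n = T n - T n.+1) -> T n @[n --> \oo] --> 0 ->
  sum_from m u = T m.
Proof. by move=> uT T0; apply/cvg_lim => //; exact: sum_telescope_cvg. Qed.

(** * Series with two alternating numerators over powers of 4 *)

Definition quaternary (R : realType) (p q : R) : R^nat :=
  fun n => (if odd n then q else p) / 4 ^+ (n./2).+1.

Section quaternary.
Context {R : realType}.
Implicit Types p q s x : R.

Lemma quaternary_gt0 p q n : 0 < p -> 0 < q -> 0 < quaternary p q n.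
Proof. by move=> p0 q0; rewrite divr_gt0 ?exprn_gt0 //; case: ifP. Qed.

Lemma le_quaternary p q p' q' n :
  p <= p' -> q <= q' -> quaternary p q n <= quaternary p' q' n.
Proof.
by move=> pp qq; rewrite ler_pM2r ?invr_gt0 ?exprn_gt0 //; case: ifP.
Qed.

Lemma quaternary_cvg0 p q : quaternary p q n @[n --> \oo] --> 0.
Proof.
apply: (@bounded_div4_cvg0 _ _ (`|p| + `|q|)) => n.
by case: ifP => _; rewrite ?lerDl ?lerDr.
Qed.

(** The tail sums in closed form, again of alternating shape: $(p+q)/3$ over $4^k$ from index $2k$
    on, and less by the single term $p/4^{k+1}$ from index $2k+1$ on. *)
Definition quaternary_tail p q : R^nat :=
  quaternary (4 * ((p + q) / 3)) (4 * ((p + q) / 3) - p).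

Lemma quaternary_tailB p q n :
  quaternary p q n = quaternary_tail p q n - quaternary_tail p q n.+1.
Proof.
rewrite /quaternary_tail /quaternary /= uphalf_half.
have := @expf_neq0 R 4 (n./2) _; case: (odd n) => /= h; rewrite ?add1n ?add0n !exprS;
  field; exact: h.
Qed.

Lemma sum_from_quaternary p q m : sum_from m (quaternary p q) = quaternary_tail p q m.
Proof.
apply: sum_from_telescope; first exact: quaternary_tailB.
exact: quaternary_cvg0.
Qed.

Lemma quaternary_cvg p q : cvgn (series (quaternary p q)).
Proof.
apply/cvg_ex; exists (quaternary_tail p q 0).
apply: sum_telescope_cvg; first exact: quaternary_tailB.
exact: quaternary_cvg0.
Qed.

Lemma quaternary_tail_double p q k :
  quaternary_tail p q k.*2 = (p + q) / 3 / 4 ^+ k.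
Proof.
rewrite /quaternary_tail /quaternary odd_double doubleK exprS.
by have := @expf_neq0 R 4 k _ => h; field; exact: h.
Qed.

End quaternary.

(** * Bounds on subsums of a nonnegative series *)

Section subsums.
Context {R : realType} (u : R^nat) (eps : nat -> bool).
Hypotheses (u_ge0 : forall n, 0 <= u n) (u_cvg : cvgn (series u)).

Local Notation v := (fun n => (eps n)%:R * u n).

Lemma subseries_ge0 n : 0 <= (eps n)%:R * u n.
Proof. by rewrite mulr_ge0. Qed.

Lemma subseries_le n : (eps n)%:R * u n <= u n.
Proof. by case: (eps n); rewrite ?mul1r ?mul0r. Qed.

Lemma is_cvg_subseries : cvgn (series v).
Proof.
exact: (series_le_cvg subseries_ge0 u_ge0 subseries_le u_cvg).
Qed.

Lemma le_sum_from_subseries k : (eps k)%:R * u k <= sum_from 0 v.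
Proof.
apply: limr_ge; first exact: is_cvg_subseries.
near=> n; have kn : (k < n)%N by near: n; exact: nbhs_infty_gt.
rewrite big_mkord (bigD1 (Ordinal kn)) //= lerDl.
by apply: sumr_ge0 => i _; exact: subseries_ge0.
Unshelve. all: end_near. Qed.

Lemma sum_from_subseries_le m :
  (forall i, (i < m)%N -> eps i = false) -> sum_from 0 v <= sum_from m u.
Proof.
move=> eps0; have cu : cvgn (fun n => \sum_(m <= i < n) u i).
  by rewrite (is_cvg_series_restrict m u).
apply: ler_lim => //; first exact: is_cvg_subseries.
near=> n; have mn : (m <= n)%N by near: n; exact: nbhs_infty_ge.
rewrite (@big_cat_nat _ _ _ m 0 n) //= big_nat big1 ?add0r.
  by apply: ler_sum => i _; exact: subseries_le.
by move=> i /andP[_ im]; rewrite eps0 // mul0r.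
Unshelve. all: end_near. Qed.

End subsums.

(** * Gaps, base-4 expansions and topological types *)

Section achievement.
Context {R : realType}.
Implicit Types p q s x : R.

Lemma achievement_set_ge0 (u : R^nat) x :
  (forall n, 0 <= u n) -> cvgn (series u) -> achievement_set u x -> 0 <= x.
Proof.
move=> u0 uc [eps ->]; apply: le_trans (le_sum_from_subseries eps u0 uc 0).
exact: subseries_ge0.
Qed.

Lemma achievement_set0 (u : R^nat) : achievement_set u 0.
Proof.
exists (fun=> false); apply/esym/cvg_lim => //.
rewrite (_ : (fun n => _) = fun=> 0); first exact: cvg_cst.
by apply/funext => n; rewrite big1 // => i _; rewrite mul0r.
Qed.

Lemma achievement_set_sum (u : R^nat) : achievement_set u (sum_from 0 u).
Proof.
by exists (fun=> true); congr (sum_from 0 _); apply/funext => n; rewrite mul1r.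
Qed.

(** A subsum that uses one of the first $2k$ terms is at least that term, hence at least $s/4^k$; a
    subsum that uses none is at most the tail $(p+q)/3/4^k$. *)
Lemma quaternary_gap p q s k x : 0 < s -> s <= p -> s <= q ->
  (p + q) / 3 / 4 ^+ k < x < s / 4 ^+ k ->
  ~ achievement_set (quaternary p q) x.
Proof.
move=> s0 sp sq /andP[lx xu] [eps xE].
have u0 n : 0 <= quaternary p q n by apply/ltW/quaternary_gt0; lra.
have uc := @quaternary_cvg R p q.
have [[i [ik ei]]|noeps] := pselect (exists i, (i < k.*2)%N /\ eps i).
  have := le_sum_from_subseries eps u0 uc i; rewrite -xE ei mul1r leNgt.
  case/negP; apply: lt_le_trans xu _; rewrite /quaternary.
  apply: ler_pM; rewrite ?invr_ge0 ?exprn_ge0 ?(ltW s0)//; first by case: ifP.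
  rewrite lef_pV2 ?posrE ?exprn_gt0 // ler_eXn2l ?ltr1n //.
  by have := odd_double_half i; lia.
have := @sum_from_subseries_le R _ eps u0 uc k.*2 _.
rewrite -xE sum_from_quaternary quaternary_tail_double leNgt lx => H.
suff: false by []; apply: H => i ik; apply/negbTE/negP => ei.
by apply: noeps; exists i.
Qed.

(* These are the binary digits of the leading base-4 digit of [y] in [[0, 1]];
   it is 3 for [y = 1]. *)
Definition high_bit (y : R) := 1 / 2 <= y.
Definition low_bit (y : R) := 1 / 4 <= y - (high_bit y)%:R / 2.
Definition shift4 (y : R) := 4 * y - (2 * (high_bit y)%:R + (low_bit y)%:R).

Lemma shift4_itv y : 0 <= y <= 1 -> 0 <= shift4 y <= 1.
Proof.
move=> y01; rewrite /shift4 /low_bit /high_bit.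
case: (lerP (1 / 2) y) => h /=; case: (lerP (1 / 4)) => /= h'; lra.
Qed.

(** Each pair of terms contributes a base-4 digit times $s/4^{k+1}$, so a choice of terms amounts to
    a base-4 expansion of $x/s$. *)
Lemma achievement_set_base4 s : 0 < s ->
  achievement_set (quaternary s (2 * s)) = `[0, s]%classic.
Proof.
move=> s0; have u0 n : 0 <= quaternary s (2 * s) n.
  by apply/ltW/quaternary_gt0; lra.
have uc := @quaternary_cvg R s (2 * s).
apply/seteqP; split => x; rewrite /= in_itv /=.
  move=> xE; rewrite (achievement_set_ge0 u0 uc xE) /=; case: xE => eps ->.
  have /le_trans := @sum_from_subseries_le R _ eps u0 uc 0 (fun _ h => match notF h with end).
  by apply; rewrite sum_from_quaternary (quaternary_tail_double _ _ 0); lra.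
move=> xs; pose y k := iter k shift4 (x / s).
have y01 k : 0 <= y k <= 1.
  elim: k => [|k ih]; last exact: shift4_itv.
  by case/andP: xs => x0 xs; rewrite /y /= divr_ge0 ?(ltW s0) //= ler_pdivrMr ?mul1r.
exists (fun n => if odd n then high_bit (y n./2) else low_bit (y n./2)).
(* [f n] over its power of 4 is the part of [x] left to represent before index [n]: $s\,y_k/4^k$ at
   $n=2k$, and at $n=2k+1$ the low bit, carried by the term $s$, has been subtracted. Consecutive
   remainders differ by the chosen term, so the sum telescopes to [x]. *)
pose f n := 4 * s * y n./2 - if odd n then s * (low_bit (y n./2))%:R else 0.
rewrite (@sum_from_telescope _ _ (fun n => f n / 4 ^+ (n./2).+1)).
- by rewrite /f /= /y /=; field; lra.
- move=> n; rewrite /quaternary /f /= uphalf_half.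
  have := @expf_neq0 R 4 (n./2) _.
  by case: (odd n) => /= h; rewrite ?add1n ?add0n !exprS /y /= ?/shift4; field; exact: h.
- apply: (@bounded_div4_cvg0 _ _ (4 * s)) => n; rewrite /f.
  move: (y n./2) (y01 n./2) (low_bit _) => z z01 d; rewrite ler_norml.
  by case: (odd n); case: d => /=; nra.
Qed.

(** The interval that contains the minimum 0 must start there and has positive length, so it would
    catch [z n] for large [n]. *)
Lemma not_finite_union_of_gaps_at_min (A : set R) (z : R^nat) :
  A 0 -> (forall x, A x -> 0 <= x) ->
  (forall n, 0 < z n) -> z n @[n --> \oo] --> 0 -> (forall n, ~ A (z n)) ->
  ~ finite_union_of_intervals A.
Proof.
move=> A0 Age0 z0 zcvg zA [s [slt AE]].
have := A0; rewrite AE => -[[l r] ps /= /andP[l0 r0]].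
have lr := slt _ ps; rewrite /= in lr.
have lE : l = 0.
  apply/eqP; rewrite eq_le l0 /=; apply: Age0; rewrite AE.
  by exists (l, r) => //=; rewrite lexx ltW.
have r_gt0 : 0 < r by rewrite -lE.
have [N _ /(_ N (leqnn N)) /=] := cvgr0_norm_lt _ zcvg _ r_gt0.
rewrite ger0_norm ?ltW // => zr; apply: (zA N); rewrite AE.
by exists (l, r) => //=; rewrite lE !ltW.
Qed.

Lemma homeomorphic_connected (T U : topologicalType) (A : set T) (B : set U) :
  homeomorphic A B -> connected A -> connected B.
Proof.
move=> [f [g [fAB gBA [gf fg] fc _]]] cA.
rewrite (_ : B = f @` A); first exact: connected_continuous_connected.
apply/seteqP; split => [y By|_ [x Ax <-]]; last exact: fAB.
by exists (g y); [exact: gBA | exact: fg].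
Qed.

(** Components are singletons, yet a connected space would put the constant sequences [true] and
    [false] in one component. *)
Lemma cantor_space_disconnected : ~ connected [set: cantor_space].
Proof.
move=> cC; have := zero_dimension_totally_disconnected cantor_zero_dimensional.
move=> /(_ (fun=> true : bool)) => /(_ I) cE.
have := @connected_component_max cantor_space setT setT (fun=> true) I (fun _ => id) cC.
by rewrite cE => /(_ (fun=> false) I) /(congr1 (@^~ 0%N)).
Qed.

Lemma guthrie_nymann_disconnected : ~ connected (achievement_set (@guthrie_nymann R)).
Proof.
move=> /connected_intervalP gni.
(* The sequence is [quaternary 3 2]. The point 11/24 is the midpoint of the gap from 5/12 to 1/2,
   between the members 0 and 5/3. *)
apply: (@quaternary_gap 3 2 2 1 (11 / 24)); rewrite ?expr1; try lra.
apply: (gni _ _ (achievement_set0 _) (achievement_set_sum _)).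
by rewrite (sum_from_quaternary 3 2) (quaternary_tail_double _ _ 0) expr0; lra.
Qed.

End achievement.

Theorem mainTheorem1 (R : realType) :
  exists a b c : R^nat,
    (forall n, 0 < a n) /\ (forall n, 0 < b n) /\ (forall n, 0 < c n) /\
    cvgn (series a) /\ cvgn (series b) /\
    same_topological_type (achievement_set a) (achievement_set b) /\
    (forall n,
       a n <= c n <= b n /\
       (b n <= sum_from n.+1 a \/ sum_from n.+1 b < a n)) /\
    ~ same_topological_type3 (achievement_set a) (achievement_set b)
        (achievement_set c).
Proof.
have itv_union (s : R) : 0 < s -> finite_union_of_intervals `[0, s]%classic.
  move=> s0; exists [:: (0, s)]; split=> [p|]; first by rewrite inE => /eqP ->.
  apply/seteqP; split => x; rewrite /= in_itv /=.
    by move=> xs; exists (0, s) => //; rewrite inE.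
  by move=> [p]; rewrite inE => /eqP ->.
have E1 := @achievement_set_base4 R 1 ltr01.
have E2 := @achievement_set_base4 R (3 / 2) ltac:(lra).
exists (quaternary 1 (2 * 1)), (quaternary (3 / 2) (2 * (3 / 2))), (quaternary (3 / 2) 2).
do 3![split; first by move=> n; apply: quaternary_gt0; lra].
do 2![split; first exact: quaternary_cvg].
split; first by exists FiniteUnionOfIntervals; rewrite /= E1 E2; split; apply: itv_union; lra.
split.
  move=> n; split; first by apply/andP; split; apply: le_quaternary; lra.
  rewrite !sum_from_quaternary /quaternary_tail /quaternary /= uphalf_half.
  have e0 : 0 < (4 ^+ (n./2).+1 : R)^-1 by rewrite invr_gt0 exprn_gt0.
  (* In units of [4 ^+ (n./2).+1]: at odd [n] the tail of [b] is 3/2, below the term 2 of [a]; at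
     even [n] the term 3/2 of [b] is below the tail 3 of [a]. *)
  case: (odd n) => /=; rewrite ?add1n ?add0n.
    by right; rewrite [4 ^+ (n./2).+2]exprS invfM; nra.
  by left; nra.
case=> -[] [/= tA _ tC].
(* Here 4/3 is the midpoint of 7/6, the scaled tail of [c], and 3/2, its smaller numerator. *)
- apply: (not_finite_union_of_gaps_at_min _ _ _ _ _ tC (z := fun k => 4 / 3 / 4 ^+ k)).
  + exact: achievement_set0.
  + move=> x; apply: achievement_set_ge0 => [n|]; last exact: quaternary_cvg.
    by apply/ltW/quaternary_gt0; lra.
  + by move=> n; rewrite divr_gt0 ?exprn_gt0 //; lra.
  + have := @cvg_geometric R (4 / 3) 4^-1 _; rewrite /geometric.
    under eq_fun do rewrite exprVn; apply; rewrite ger0_norm; lra.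
  + move=> k; apply: (@quaternary_gap _ _ _ (3 / 2) k); try lra.
    have e0 : 0 < (4 ^+ k : R)^-1 by rewrite invr_gt0 exprn_gt0.
    by nra.
- apply: cantor_space_disconnected; apply: homeomorphic_connected tA _.
  by rewrite E1; exact: segment_connected.
- apply: guthrie_nymann_disconnected; apply: homeomorphic_connected tA _.
  by rewrite E1; exact: segment_connected.
Qed.
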